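(* There exists a separable metric space $B$ such that none of $PM_\tau(B)$, $PM_\rho(B)$ and $PM_\delta(B)$, endowed with the uniformity of the Kantorovich–Rubinstein norm, is a uniform AR.
   Context: A (finite signed Borel) measure on $B$ is a countably additive real-valued function on the Borel $\sigma$-algebra of $B$; it is a probability measure if it is nonnegative and has total mass $1$. $PM_\tau(B)$ is the set of all $\tau$-additive probability measures on $B$ (those $\mu$ such that for each decreasing net of closed sets $Z_\alpha\subset B$ with $\bigcap_\alpha Z_\alpha=\emptyset$ the net $\mu(Z_\alpha)$ converges to $0$). $PM_\rho(B)$ is the set of all Radon probability measures on $B$ (those $\mu$ such that for each Borel set $A$, $\mu(A)=\sup\mu(K)$ over compact $K\subset A$). $PM_\delta(B)$ is the set of all probability measures that are finite linear combinations of Dirac measures. The Kantorovich–Rubinstein norm of a measure $\mu$ on a metric space $B$ is $\|\mu\|_{KR}=\sup\left|\int_B f\,d\mu\right|$ over all $1$-Lipschitz functions $f\colon B\to[-1,1]$; the uniformity on each of the sets $PM_\tau(B)$, $PM_\rho(B)$ and $PM_\delta(B)$ is that of the metric $\|\mu-\nu\|_{KR}$. A uniform AR is a metrizable uniform space $Y$ such that for every uniform embedding $i$ of $Y$ onto a closed subspace of a metrizable uniform space $Z$ there exists a uniformly continuous retraction of $Z$ onto $i(Y)$. *)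

(* Defs.v *)
From HB Require Import structures.
From mathcomp Require Import all_boot all_order all_algebra.
From mathcomp Require Import all_classical all_reals all_analysis.

Set Implicit Arguments.
Unset Strict Implicit.
Unset Printing Implicit Defensive.

Import Order.TTheory GRing.Theory Num.Theory.
Import numFieldNormedType.Exports.

Local Open Scope classical_set_scope.
Local Open Scope ring_scope.

(* A measurableType must be pointed, so the metric spaces carrying measures are
   nonempty. This matters: the empty space has no probability measure, and the
   empty uniform space is not a retract of any nonempty one. *)
#[short(type="pmetricType")]
HB.structure Definition PointedMetric (K : numDomainType) :=
  { M of Metric K M & isPointed M }.

Definition separable (T : topologicalType) :=
  exists2 D : set T, countable D & dense D.

Section uniform_AR.
Context (R : realType).

Definition metrizable_uniformity (Z : uniformType) :=
  exists d : Z -> Z -> R,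
    [/\ forall x y, d x y = 0 <-> x = y,
        forall x y, d x y = d y x,
        forall x y z, d x z <= d x y + d y z &
        @entourage Z = entourage_ (fun x e => [set y | d x y < e])].

Definition uniform_embedding (Y Z : uniformType) (i : Y -> Z) :=
  [/\ injective i, unif_continuous i &
      forall E : set (Y * Y), entourage E ->
        exists2 F : set (Z * Z), entourage F &
          forall x y, F (i x, i y) -> E (x, y)].

Definition unif_retraction (Z : uniformType) (A : set Z) (r : Z -> Z) :=
  [/\ unif_continuous r, forall z, A (r z) & forall z, A z -> r z = z].

Definition uniform_AR (Y : uniformType) :=
  metrizable_uniformity Y /\
  forall (Z : uniformType) (i : Y -> Z), metrizable_uniformity Z ->
    uniform_embedding i -> closed (range i) ->
    exists r : Z -> Z, unif_retraction (range i) r.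

End uniform_AR.

Definition borel (T : ptopologicalType) := g_sigma_algebraType (@open T).

(* The integral against a signed measure is the difference of the integrals
   against the two parts of its Jordan decomposition; it does not depend on the
   chosen Hahn decomposition. *)
Section charge_integral.
Context d (T : measurableType d) (R : realType).
Implicit Type nu : {charge set T -> \bar R}.

Definition hahn_pos nu : set T := projT1 (cid (Hahn_decomposition nu)).

Definition hahn_neg nu : set T :=
  projT1 (cid (projT2 (cid (Hahn_decomposition nu)))).

Lemma hahnP nu : hahn_decomposition nu (hahn_pos nu) (hahn_neg nu).
Proof. exact: projT2 (cid (projT2 (cid (Hahn_decomposition nu)))). Qed.

Definition charge_integral nu (f : T -> R) : R :=
  \int[jordan_pos (hahnP nu)]_x f x - \int[jordan_neg (hahnP nu)]_x f x.

End charge_integral.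

Section kantorovich_rubinstein.
Context (R : realType) (B : pmetricType R).

Definition lip1 : set (B -> R) :=
  [set f | (forall x y, `|f x - f y| <= mdist x y) /\
           (forall x, -1 <= f x <= 1)].

Definition kr_norm (nu : {charge set (borel B) -> \bar R}) : R :=
  sup [set `|charge_integral nu f| | f in lip1].

(* A library [probability] is a function on all subsets, arbitrary outside the
   sigma-algebra. Giving it the value 0 on non-Borel sets makes it determined by
   its restriction to the Borel sigma-algebra, so that PM is the set of
   probability measures on B and kr_norm (mu - nu) is a genuine metric on it, not
   merely a pseudometric: a non-Hausdorff space would trivially fail to be a
   uniform AR. *)
Record PM := MkPM {
  pm_prob :> probability (borel B) R ;
  pm_nonborel : forall A : set (borel B), ~ measurable A -> pm_prob A = 0%E }.

HB.instance Definition _ := gen_eqMixin PM.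
HB.instance Definition _ := gen_choiceMixin PM.

Definition charge_diff (mu nu : PM) : {charge set (borel B) -> \bar R} :=
  cadd (charge_of_finite_measure mu) (copp (charge_of_finite_measure nu)).

Definition kr_dist (mu nu : PM) : R := kr_norm (charge_diff mu nu).

End kantorovich_rubinstein.

Section kr_metric.
Context (R : realType) (B : pmetricType R).
Implicit Types (mu nu : PM B) (f : B -> R) (A C U : set B) (x y z : B).

Let lip1_cst0 : lip1 (fun _ : B => 0 : R).
Proof. by split => *; rewrite ?subrr ?normr0 ?mdist_ge0// lerN10 ler01. Qed.

Let lip1_measurable f : lip1 f ->
  measurable_fun [set: borel B] (f : borel B -> R).
Proof.
move=> [lf _].
have cf : continuous f.
  move=> x; apply/cvgrPdist_lt => e e0; near=> y.
  rewrite (le_lt_trans (lf _ _))//; near: y.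
  by have := nbhsx_ballx x e e0; rewrite ballEmdist.
apply: (measurability _ (measurable_realfun.RGenOpens.measurableE R)) => _ [_ [a [b ->] <-]].
rewrite setTI; apply: sub_sigma_algebra.
by apply: open_comp => // x _; exact: cf.
Unshelve. all: by end_near. Qed.

Let lip1_integrable f (mu : {finite_measure set (borel B) -> \bar R}) : lip1 f ->
  mu.-integrable [set: borel B] (EFin \o f).
Proof.
move=> lf; apply: measurable_bounded_integrable => //.
- by rewrite ltey_eq fin_num_measure.
- exact: lip1_measurable.
- exists 1; split=> // e e1 x _ /=; rewrite (le_trans _ (ltW e1))//.
  by rewrite ler_norml lf.2.
Qed.

Let charge_integral_diff mu nu f : lip1 f ->
  charge_integral (charge_diff mu nu) f = \int[mu]_x f x - \int[nu]_x f x.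
Proof.
move=> lf; rewrite /charge_integral.
set P := hahnP _.
apply/eqP; rewrite subr_eq addrAC -subr_eq opprK; apply/eqP.
have E : \int[measure_add mu (jordan_neg P)]_x f x =
  \int[measure_add nu (jordan_pos P)]_x f x.
  rewrite /Rintegral; congr fine; apply: eq_measure_integral => A mA _.
  transitivity (mu A + jordan_neg P A)%E; first exact: measure_addE.
  transitivity (nu A + jordan_pos P A)%E; last exact/esym/measure_addE.
  have D : (mu A - nu A = jordan_pos P A - jordan_neg P A)%E.
    by rewrite [LHS](jordan_decomp P mA) /cadd/= /cscale EFinN mulN1e.
  have fmu : mu A \is a fin_num by exact: fin_num_measure.
  have fnu : nu A \is a fin_num by exact: fin_num_measure.
  have fp : jordan_pos P A \is a fin_num by exact: fin_num_measure.
  have fn : jordan_neg P A \is a fin_num by exact: fin_num_measure.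
  by rewrite -(subeK (mu A) fnu) D addeAC subeK// addeC.
have add (m1 m2 : {finite_measure set (borel B) -> \bar R}) :
    \int[measure_add m1 m2]_x f x = \int[m1]_x f x + \int[m2]_x f x.
  rewrite /Rintegral integral_measure_add//.
  - rewrite fineD//; exact: integrable_fin_num (lip1_integrable _ lf).
  - exact: lip1_integrable.
  - exact: lip1_integrable.
by rewrite -(add mu) E (add nu) addrC.
Qed.

Let int_le1 mu f : lip1 f -> `|\int[mu]_x f x| <= 1.
Proof.
move=> lf; rewrite (le_trans (le_normr_Rintegral _ (lip1_integrable mu lf)))//.
rewrite (_ : 1 = \int[mu]_x (cst 1 x)); last first.
  by rewrite Rintegral_cst// mul1r -[1]/(fine 1%:E) -(probability_setT mu).
apply: le_Rintegral => //.
- exact: (integrable_norm (lip1_integrable mu lf)).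
- exact: finite_measure_integrable_cst.
- by move=> x _; rewrite /= ler_norml lf.2.
Qed.

Let kr_has_sup mu nu :
  has_sup [set `|charge_integral (charge_diff mu nu) f| | f in @lip1 R B].
Proof.
split; first by eexists; exists (fun=> 0).
exists 2 => _ [f lf <-]; rewrite charge_integral_diff//.
by rewrite (le_trans (ler_normB _ _))// lerD// int_le1.
Qed.

Let kr_ub mu nu f : lip1 f ->
  `|\int[mu]_x f x - \int[nu]_x f x| <= kr_dist mu nu.
Proof.
move=> lf; rewrite -charge_integral_diff//; apply: sup_upper_bound => //.
by exists f.
Qed.

Let kr_le mu nu (c : R) :
  (forall f, lip1 f -> `|\int[mu]_x f x - \int[nu]_x f x| <= c) ->
  kr_dist mu nu <= c.
Proof.
move=> h; apply: ge_sup; first by have [] := kr_has_sup mu nu.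
by move=> _ [f lf <-]; rewrite charge_integral_diff//; exact: h.
Qed.

Let kr_dist_ge0 mu nu : 0 <= kr_dist mu nu.
Proof. exact: le_trans (kr_ub mu nu lip1_cst0). Qed.

Lemma kr_distxx mu : kr_dist mu mu = 0.
Proof.
apply/eqP; rewrite eq_le kr_dist_ge0 andbT; apply: kr_le => f _.
by rewrite subrr normr0.
Qed.

Lemma kr_dist_sym mu nu : kr_dist mu nu = kr_dist nu mu.
Proof.
by apply/eqP; rewrite eq_le !kr_le// => f lf; rewrite distrC kr_ub.
Qed.

Lemma kr_dist_triangle nu mu (la : PM B) :
  kr_dist mu la <= kr_dist mu nu + kr_dist nu la.
Proof.
apply: kr_le => f lf.
by rewrite (le_trans (ler_distD (\int[nu]_x f x) _ _))// lerD// kr_ub.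
Qed.

Let dist_to (C : set B) (x : B) : R := inf [set mdist x y | y in C].

Let dist_to_has_inf C x : C !=set0 -> has_inf [set mdist x y | y in C].
Proof.
move=> [c Cc]; split; first by exists (mdist x c), c.
by exists 0 => _ [y _ <-]; exact: mdist_ge0.
Qed.

Let dist_to_ge0 C x : C !=set0 -> 0 <= dist_to C x.
Proof.
move=> /(dist_to_has_inf x)[C0 _].
by apply: lb_le_inf => // _ [y _ <-]; exact: mdist_ge0.
Qed.

Let dist_to_le C x y : C y -> dist_to C x <= mdist x y.
Proof.
move=> Cy; apply: ge_inf; last by exists y.
by have [] := dist_to_has_inf x (ex_intro _ y Cy).
Qed.

Let dist_to_triangle C x z : C !=set0 -> dist_to C x <= mdist x z + dist_to C z.
Proof.
move=> C0; rewrite -lerBlDl; apply: lb_le_inf.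
  by have [] := dist_to_has_inf z C0.
move=> _ [y Cy <-]; rewrite lerBlDl (le_trans (dist_to_le x Cy))//.
exact: metric_triangle.
Qed.

Let bump C (n : nat) (x : B) : R := Num.min n.+1%:R^-1 (dist_to C x).

Let bump_lip1 C n : C !=set0 -> lip1 (bump C n).
Proof.
move=> C0; have n0 : 0 < n.+1%:R^-1 :> R by rewrite invr_gt0 ltr0n.
have n1 : n.+1%:R^-1 <= 1 :> R by rewrite invf_le1 ?ltr0n// ler1n.
split=> [x y|x]; last first.
  rewrite /bump ge_min n1 andbT (le_trans (_ : -1 <= 0))// ?lerN10//.
  by rewrite le_min (ltW n0) dist_to_ge0.
suff h u v : bump C n u - bump C n v <= mdist u v.
  by rewrite ler_norml lerNl opprB h andbT metric_sym h.
rewrite lerBlDr /bump.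
rewrite addr_minr le_min; apply/andP; split; rewrite ge_min.
  by rewrite lerDr mdist_ge0.
by rewrite dist_to_triangle// orbT.
Qed.

Let kr_eq0_open mu nu (U : set B) : kr_dist mu nu = 0 -> open U -> mu U = nu U.
Proof.
move=> krE oU.
have [C0|/set0P C0] := eqVneq (~` U) set0.
  by rewrite -(setCK U) C0 setC0 -[LHS]/(mu setT) !probability_setT.
have C0' := C0; set C := ~` U in C0.
pose h n (x : borel B) : \bar R := (n.+1%:R%:E * (bump C n x)%:E)%E.
have inth (m : PM B) n : (\int[m]_x h n x = (n.+1%:R * \int[m]_x bump C n x)%:E)%E.
  rewrite integralZl//; last exact: lip1_integrable (bump_lip1 n C0).
  rewrite EFinM; congr (_ * _)%E; rewrite fineK//.
  exact: integrable_fin_num (lip1_integrable m (bump_lip1 n C0)).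
have hE n x : h n x = (Num.min 1 (n.+1%:R * dist_to C x))%:E.
  rewrite /h /bump -EFinM minr_pMr ?ler0n// mulfV// pnatr_eq0//.
have mU : measurable (U : set (borel B)) by exact: sub_sigma_algebra.
have lim_h x : h n x @[n --> \oo] --> (\1_U x)%:E.
  have [Ux|Cx] := pselect (U x).
  - rewrite indicE mem_set//.
    have /nbhs_ballP [e /= e0 eU] : nbhs x U by exact: open_nbhs_nbhs.
    have ed : e <= dist_to C x.
      apply: lb_le_inf; first by have [] := dist_to_has_inf x C0.
      move=> _ [y Cy <-]; rewrite leNgt; apply/negP => xy; apply: Cy.
      by apply: eU; rewrite ballEmdist.
    apply: cvg_near_cst; near=> n; rewrite hE; congr EFin; apply/min_idPl.
    rewrite (le_trans _ (ler_wpM2l _ ed))// -ler_pdivrMr// mul1r.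
    rewrite (@le_trans _ _ n%:R)// ?ler_nat//; near: n.
    exact: nbhs_infty_ger.
  - rewrite indicE memNset//.
    have d0 : dist_to C x = 0.
      apply/eqP; rewrite eq_le dist_to_ge0// andbT -(mdistxx x).
      exact: dist_to_le.
    rewrite (_ : (h ^~ x) = fun=> 0%E); first exact: cvg_cst.
    by apply/funext => n; rewrite hE d0 mulr0; congr EFin; apply/min_idPr.
have intU (m : PM B) :
    (n.+1%:R * \int[m]_x bump C n x)%:E @[n --> \oo] --> m U.
  under eq_fun do rewrite -inth.
  rewrite -[X in nbhs (m X)](setIT U) -[m _]integral_indic//.
  rewrite (_ : (fun x => (\1_U x)%:E) = fun x => limn (h ^~ x)); last first.
    by apply/funext => x; apply/esym/cvg_lim => //; exact: lim_h.
  apply: cvg_monotone_convergence => //.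
  - move=> n; have lb := lip1_integrable m (bump_lip1 n C0).
    exact: measurable_int (integrableZl measurableT n.+1%:R lb).
  - move=> n x _; rewrite hE lee_fin le_min ler01 mulr_ge0//.
    exact: dist_to_ge0.
  - move=> x _ n k nk; rewrite !hE lee_fin le_min ge_min lexx/=.
    by rewrite ge_min ler_wpM2r ?orbT ?dist_to_ge0// ler_nat.
have intE n : \int[nu]_x bump C n x = \int[mu]_x bump C n x.
  apply/esym/eqP; rewrite -subr_eq0 -normr_le0 -krE.
  exact: kr_ub (bump_lip1 n C0).
have := intU nu; under eq_fun do rewrite intE.
by move/(cvg_unique (@ereal_hausdorff R) (intU mu)).
Unshelve. all: by end_near. Qed.

Lemma kr_dist_positivity mu nu : kr_dist mu nu = 0 -> mu = nu.
Proof.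
move=> krE.
have E (A : set (borel B)) : measurable A -> mu A = nu A.
  have Gm : @open B `<=` (measurable : set (set (borel B))).
    exact: sub_sigma_algebra.
  apply: (@g_sigma_algebra_measure_unique _ R (borel B) _ Gm (fun=> setT)) => //.
  - by move=> _; exact: openT.
  - by rewrite bigcup_const.
  - exact: openI.
  - by move=> U; exact: kr_eq0_open.
  - by move=> _; rewrite ltey_eq fin_num_measure.
have {}E : pm_prob mu = pm_prob nu :> (set (borel B) -> \bar R).
  apply/funext => A; have [/E//|nA] := pselect (measurable A).
  by rewrite !pm_nonborel.
have {}E : pm_prob mu = pm_prob nu.
  move: (pm_prob mu) (pm_prob nu) E.
  move=> [p [[a0 a1] [a2] [a3] [a4] [a5] [a6] [a7]]].
  move=> [q [[b0 b1] [b2] [b3] [b4] [b5] [b6] [b7]]] /= pq; subst q.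
  rewrite (Prop_irrelevance b0 a0) (Prop_irrelevance b1 a1).
  rewrite (Prop_irrelevance b2 a2) (Prop_irrelevance b3 a3).
  rewrite (Prop_irrelevance b4 a4) (Prop_irrelevance b5 a5).
  by rewrite (Prop_irrelevance b6 a6) (Prop_irrelevance b7 a7).
case: mu nu E {krE} => [p np] [q nq] /= pq; subst q.
by congr MkPM; exact: Prop_irrelevance.
Qed.

End kr_metric.

HB.instance Definition _ (R : realType) (B : pmetricType R) :=
  isMetric.Build R (PM B) (@kr_distxx R B) (@kr_dist_positivity R B)
    (@kr_dist_sym R B) (@kr_dist_triangle R B).

(* As a uniform space, a set A of probability measures is the type [set_type A]
   with the initial uniformity of the inclusion, that is, the uniformity of the
   restriction of the metric. *)
Lemma entourage_set_PM (R : realType) (B : pmetricType R) (A : set (PM B)) :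
  @entourage (set_type A) =
  entourage_ (fun (mu : A) (e : R) =>
    [set nu : A | kr_dist (set_val mu) (set_val nu) < e]).
Proof.
by rewrite -entourage_ballE.
Qed.

Definition directed_preorder (I : Type) (le : I -> I -> Prop) :=
  [/\ inhabited I,
      forall i, le i i,
      forall i j k, le i j -> le j k -> le i k &
      forall i j, exists2 k, le i k & le j k].

Definition net_filter (I : Type) (le : I -> I -> Prop) : set_system I :=
  filter_from setT (fun i => [set j | le i j]).

Section classes_of_probability_measures.
Context (R : realType) (B : pmetricType R).

Definition tau_additive (mu : PM B) :=
  forall (I : Type) (le : I -> I -> Prop) (Z : I -> set B),
    directed_preorder le ->
    (forall i, closed (Z i)) ->
    (forall i j, le i j -> Z j `<=` Z i) ->
    \bigcap_i Z i = set0 ->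
    mu (Z i) @[i --> net_filter le] --> 0%E.

Definition radon (mu : PM B) :=
  forall A : set (borel B), measurable A ->
    mu A = ereal_sup [set mu K | K in [set K : set B | compact K /\ K `<=` A]].

Definition finite_dirac_combination (mu : PM B) :=
  exists (n : nat) (c : 'I_n -> R) (x : 'I_n -> borel B),
    forall A : set (borel B), measurable A ->
      mu A = (\sum_(i < n) (c i)%:E * \d_(x i) A)%E.

Definition PM_tau : set (PM B) := [set mu | tau_additive mu].
Definition PM_rho : set (PM B) := [set mu | radon mu].
Definition PM_delta : set (PM B) := [set mu | finite_dirac_combination mu].

End classes_of_probability_measures.

Arguments PM_tau {R} B.
Arguments PM_rho {R} B.
Arguments PM_delta {R} B.

(* Main.v *)
Require Import Defs.
From HB Require Import structures.
From mathcomp Require Import all_boot all_order all_algebra.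
From mathcomp Require Import all_classical all_reals all_analysis.
From mathcomp Require Import ring lra.

(** The space [B] is built from Hamming cubes. For all naturals [m], [n] take
    the cube [{0,1}^(n+1)] with the normalized Hamming distance, put distinct
    cubes at distance 1, and glue to every vertex of the [(m, n)]-th cube
    countably many whiskers of length [1 / (m + 1)], one for each list of bits
    that encodes the vertex. [B] consists of the tips of the whiskers. It is
    countable and discrete, so it is separable, all its subsets are Borel, and
    every Dirac measure lies in each of the three classes of measures.

    Suppose that a class [Y] of probability measures containing all Dirac
    measures is a uniform AR. Then the 1-Lipschitz map from tips to Dirac
    measures can be transferred to the roots of the whiskers: there is a map
    [Phi] from the cubes to [Y] that is uniformly continuous for the Hamming
    distance on each cube, with a modulus common to all the cubes, and that
    sends the root of a short whisker close to the Dirac measure at its tip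
    ([uniform_AR_approx_extension]). To see this, embed [Y] by Kuratowski's map
    in the bounded functions on [Y], add a height coordinate, and let [Z]
    consist of [Y] at height 0 and of all the bounded functions at nonzero
    height. Then [Y] is closed in [Z] whether or not it is complete, an
    inf-convolution puts the root of a whisker at a height equal to the length
    of that whisker, and a uniform retraction of [Z] onto [Y] gives [Phi].

    Such a [Phi] does not exist. Fix [m] such that [Phi] is within 1/4 of the
    Dirac measures for all whiskers of length [1 / (m + 1)]. On the tips of
    these whiskers the sign of a coordinate of the cube becomes 1-Lipschitz
    after multiplication by [1 / (m + 1)], independently of [n]. So once [n] is
    large, flipping one coordinate of a vertex [v], which is a move of length
    [1 / (n + 1)], hardly changes the integral of that sign against [Phi v].
    Averaged over all vertices [v], the correlation of the sign of the [i]-th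
    coordinate of [v] with its mean against [Phi v] is then negligible for
    every [i] ([correlation_with_vertex]). But the sum of these correlations
    over [i] is at least [n + 1] times the integral of [1 - 2 hamming v]
    against [Phi v], so for some [v] the measure [Phi v] is at Hamming distance
    almost 1/2 from [v] on average: it is far from the Dirac measure at the tip
    over [v] ([far_from_vertex]). *)

Set Implicit Arguments.
Unset Strict Implicit.
Unset Printing Implicit Defensive.

Import Order.TTheory GRing.Theory Num.Theory.
Import numFieldNormedType.Exports.

Local Open Scope classical_set_scope.
Local Open Scope ring_scope.

(** * Extending maps into a uniform AR *)

Section collar_def.
Context (R : realType) (Y : Type) (d : Y -> Y -> R).

(** The coordinate [None] of a bounded function on [option Y] is the height; the
    single index type makes the sup metric cover functions and heights at once,
    and it is inhabited even when [Y] is empty. *)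
Definition kuratowski (y : Y) (o : option Y) : R :=
  if o is Some y' then d y y' else 0.

(** At nonzero height every bounded function is allowed, and at height 0 only
    the Kuratowski image of [Y]: this makes the copy of [Y] closed. *)
Record collar := Collar {
  profile :> option Y -> R ;
  profile_bounded : exists M, forall o, `|profile o| <= M ;
  profile_base : profile None = 0 -> exists y, profile = kuratowski y }.

HB.instance Definition _ := gen_eqMixin collar.
HB.instance Definition _ := gen_choiceMixin collar.

Implicit Types z w v : collar.

Definition collar_dist (z w : collar) : R :=
  sup (range (fun o => `|z o - w o|)).

Lemma collar_dist_ub z w o : `|z o - w o| <= collar_dist z w.
Proof.
apply: ub_le_sup; last by exists o.
have [M zM] := profile_bounded z; have [N wN] := profile_bounded w.
by exists (M + N) => _ [p _ <-]; rewrite (le_trans (ler_normB _ _))// lerD.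
Qed.

Lemma collar_dist_le z w (c : R) :
  (forall o, `|z o - w o| <= c) -> collar_dist z w <= c.
Proof.
move=> zw; apply: ge_sup; first by exists `|z None - w None|, None.
by move=> _ [p _ <-].
Qed.

Lemma collar_distxx z : collar_dist z z = 0.
Proof.
apply/eqP; rewrite eq_le collar_dist_le => [|o]; last by rewrite subrr normr0.
exact: le_trans (collar_dist_ub z z None).
Qed.

Lemma collar_dist_positivity z w : collar_dist z w = 0 -> z = w.
Proof.
move=> zw0; have {zw0}zw : profile z = profile w.
  apply/funext => o; apply/eqP; rewrite -subr_eq0 -normr_le0 -zw0.
  exact: collar_dist_ub.
case: z w zw => [z z1 z2] [w w1 w2] /= zw; subst w.
by congr Collar; exact: Prop_irrelevance.
Qed.

Lemma collar_dist_sym z w : collar_dist z w = collar_dist w z.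
Proof. by congr sup; apply: eq_imagel => o _; rewrite distrC. Qed.

Lemma collar_dist_triangle w z v :
  collar_dist z v <= collar_dist z w + collar_dist w v.
Proof.
apply: collar_dist_le => o.
by rewrite (le_trans (ler_distD (w o) _ _))// lerD// collar_dist_ub.
Qed.

HB.instance Definition _ := isMetric.Build R collar
  collar_distxx collar_dist_positivity collar_dist_sym collar_dist_triangle.

Lemma collar_entourageE : @entourage collar =
  entourage_ (fun z (e : R) => [set w | collar_dist z w < e]).
Proof. by rewrite -entourage_ballE. Qed.

Lemma collar_metrizable : metrizable_uniformity R collar.
Proof.
exists collar_dist; split.
- move=> z w; split=> [|->]; first exact: collar_dist_positivity.
  exact: collar_distxx.
- exact: collar_dist_sym.
- by move=> z w v; exact: collar_dist_triangle.
- exact: collar_entourageE.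
Qed.

End collar_def.

Section approximate_extension.
Context (R : realType) (Y : uniformType) (d : Y -> Y -> R) (M : R).
Hypothesis dxx : forall y, d y y = 0.
Hypothesis dsym : forall y z, d y z = d z y.
Hypothesis dtri : forall y x z, d x z <= d x y + d y z.
Hypothesis d0 : forall y z, d y z = 0 -> y = z.
Hypothesis dM : forall y z, d y z <= M.
Hypothesis entE :
  @entourage Y = entourage_ (fun y (e : R) => [set z | d y z < e]).

Let d_ge0 y z : 0 <= d y z.
Proof. by have := dtri z y y; rewrite dxx (dsym z) -mulr2n pmulrn_lge0. Qed.

Let d_lip x y z : `|d x z - d y z| <= d x y.
Proof.
rewrite ler_norml; have := dtri y x z; have := dtri x y z.
by rewrite (dsym y x); lra.
Qed.

Fact base_bounded y : exists N, forall o, `|kuratowski d y o| <= N.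
Proof.
exists M => -[z|] /=; first by rewrite ger0_norm.
by rewrite normr0 (le_trans (d_ge0 y y)).
Qed.

Definition base (y : Y) : collar d :=
  Collar (base_bounded y) (fun _ => ex_intro _ y erefl).

Lemma base_isometry y z : collar_dist (base y) (base z) = d y z.
Proof.
apply/eqP; rewrite eq_le collar_dist_le => [/=|[x|]/=]; last first.
- by rewrite subrr normr0.
- exact: d_lip.
- have := collar_dist_ub (base y) (base z) (Some z).
  by rewrite /= dxx subr0 ger0_norm.
Qed.

Lemma base_embedding : uniform_embedding base.
Proof.
split.
- by move=> y z yz; apply: d0; rewrite -base_isometry yz collar_distxx.
- move=> E; rewrite collar_entourageE => -[e /= e0 eE].
  rewrite /nbhs/= entE; exists e => //= -[y z] /= yz.
  by apply: eE; rewrite /= base_isometry.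
- move=> E; rewrite entE => -[e /= e0 eE].
  exists [set zw | collar_dist zw.1 zw.2 < e].
    by rewrite collar_entourageE; exists e.
  by move=> y z /=; rewrite base_isometry => yz; exact: eE.
Qed.

Lemma base_closed : closed (range base).
Proof.
rewrite (_ : range base = ~` [set z | z None != 0]); last first.
  apply/seteqP; split=> [_ [y _ <-]/= |z /=]; first by rewrite eqxx.
  move=> /negP; rewrite negbK => /eqP/[dup] z0 /profile_base[y zy].
  exists y => //; apply: collar_dist_positivity; apply/eqP.
  rewrite eq_le collar_dist_le => [|o]; last by rewrite zy subrr normr0.
  by rewrite (le_trans _ (collar_dist_ub _ _ None)).
apply: open_closedC; rewrite openE => z /= z0.
rewrite /interior; apply/nbhs_ballP; exists `|z None| => /=.
  by rewrite normr_gt0.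
move=> w; rewrite ballEmdist /= => zw; apply: contraTneq zw => w0.
by rewrite -leNgt (le_trans _ (collar_dist_ub _ _ None))// w0 subr0.
Qed.

Context (T : Type) (h : T -> T -> R) (e : T -> R) (phi : T -> Y).
Hypothesis hxx : forall x, h x x = 0.
Hypothesis hsym : forall x y, h x y = h y x.
Hypothesis htri : forall y x z, h x z <= h x y + h y z.
Hypothesis e_gt0 : forall x, 0 < e x.
Hypothesis phi_lip : forall x y, d (phi x) (phi y) <= h x y + e x + e y.

Let h_ge0 x y : 0 <= h x y.
Proof. by have := htri y x x; rewrite hxx (hsym y) -mulr2n pmulrn_lge0. Qed.

(* The infimum over [b] of the length of a path that leaves the root of the
   whisker at [x], travels for [h] to the root at [b], climbs to the tip [phi b]
   and then goes to [y] in [Y]. *)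
Let spread x y := range (fun b => d y (phi b) + h x b + e b).

Let spread_inf x y : has_inf (spread x y).
Proof.
split; first by exists (d y (phi x) + h x x + e x), x.
by exists 0 => _ [b _ <-]; rewrite !addr_ge0// ltW.
Qed.

Let spread_le x y b : inf (spread x y) <= d y (phi b) + h x b + e b.
Proof. by apply: ge_inf; [have [] := spread_inf x y|exists b]. Qed.

Let le_spread x y (c : R) :
  (forall b, c <= d y (phi b) + h x b + e b) -> c <= inf (spread x y).
Proof.
move=> cle; apply: lb_le_inf; first by have [] := spread_inf x y.
by move=> _ [b _ <-].
Qed.

Let anchor_fun x (o : option Y) : R :=
  if o is Some y then inf (spread x y) else e x.

Fact anchor_bounded x : exists N, forall o, `|anchor_fun x o| <= N.
Proof.
have M0 : 0 <= M := le_trans (d_ge0 (phi x) (phi x)) (dM _ _).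
exists (M + e x) => -[y|] /=; last first.
  by rewrite ger0_norm ?lerDr// ltW.
rewrite ger0_norm; last by apply: le_spread => b; rewrite !addr_ge0// ltW.
by rewrite (le_trans (spread_le x y x))// hxx addr0 lerD.
Qed.

Fact anchor_base x :
  anchor_fun x None = 0 -> exists y, anchor_fun x = kuratowski d y.
Proof. by move=> /= ex0; have := e_gt0 x; rewrite ex0 ltxx. Qed.

Definition anchor x : collar d := Collar (anchor_bounded x) (@anchor_base x).

Lemma anchor_lip x y (c : R) : h x y <= c -> `|e x - e y| <= c ->
  collar_dist (anchor x) (anchor y) <= c.
Proof.
move=> hc ec; apply: collar_dist_le => -[z|] //=.
have le u v : h u v <= c -> inf (spread u z) <= inf (spread v z) + c.
  move=> uv; rewrite -lerBlDr; apply: le_spread => b; rewrite lerBlDr.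
  rewrite (le_trans (spread_le u z b))//.
  have := htri v u b; lra.
have := le _ _ hc; have := le y x; rewrite hsym => /(_ hc).
by rewrite ler_norml; lra.
Qed.

Lemma anchor_base_dist x : collar_dist (anchor x) (base (phi x)) <= e x.
Proof.
apply: collar_dist_le => -[y|] /=; last by rewrite subr0 gtr0_norm.
rewrite ler_norml; apply/andP; split.
  rewrite lerBrDr; apply: le_spread => b.
  have := dtri (phi b) (phi x) y; have := phi_lip x b.
  rewrite (dsym y); lra.
by have := spread_le x y x; rewrite hxx (dsym y); lra.
Qed.

(** A point [x] of [T] is the root of a whisker of length [e x] with tip
    [phi x], and [h] is the distance between roots. Since [e] is positive, the
    collar has room for the roots at height [e], off the copy of [Y]. There the
    distance of two roots is controlled by [h] and by the difference of their
    heights, and each root is at distance [e x] from its tip; a uniform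
    retraction of the collar onto [Y] turns these bounds into those on [Phi]. *)
Lemma uniform_AR_approx_extension : uniform_AR R Y ->
  exists Phi : T -> Y, forall eps : R, 0 < eps -> exists2 delta : R, 0 < delta &
    (forall x y, h x y < delta -> `|e x - e y| < delta ->
      d (Phi x) (Phi y) < eps) /\
    (forall x, e x < delta -> d (Phi x) (phi x) < eps).
Proof.
move=> [_ /(_ _ base (collar_metrizable d) base_embedding base_closed)].
move=> [r [rcont rbase rid]].
have [Phi PhiE] : exists Phi : T -> Y, forall x, base (Phi x) = r (anchor x).
  suff /choice[Phi PhiE] : forall x, exists y, base y = r (anchor x).
    by exists Phi.
  by move=> x; have [y _ yE] := rbase (anchor x); exists y.
exists Phi => eps eps0.
have : entourage [set zw | collar_dist (r zw.1) (r zw.2) < eps].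
  apply: (rcont [set zw | collar_dist zw.1 zw.2 < eps]).
  by rewrite /nbhs/= collar_entourageE; exists eps.
rewrite collar_entourageE => -[delta /= delta0 rdelta].
(* Half of delta turns the strict bounds on [h] and [e] into a non-strict bound
   on the collar distance that is still below delta. *)
exists (delta / 2); first by rewrite divr_gt0.
have half : delta / 2 < delta by lra.
split=> [x y hxy exy|x ex].
  rewrite -base_isometry !PhiE; apply: (rdelta (anchor x, anchor y)) => /=.
  by rewrite (le_lt_trans _ half)// anchor_lip// ltW.
rewrite -base_isometry PhiE -[base _]rid; last by exists (phi x).
apply: (rdelta (anchor x, base (phi x))) => /=.
by rewrite (le_lt_trans (anchor_base_dist x))// (lt_trans ex).
Qed.
End approximate_extension.

(** * The Kantorovich-Rubinstein distance and Dirac measures *)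

Section kr.
Context (R : realType) (B : pmetricType R).
Implicit Types (mu nu : PM B) (f : B -> R).

Lemma lip1_measurable f : lip1 f ->
  measurable_fun [set: borel B] (f : borel B -> R).
Proof.
move=> [flip _].
have fcont : continuous f.
  move=> x; apply/cvgrPdist_lt => e e0; apply/nbhs_ballP; exists e => //= y.
  by rewrite ballEmdist /=; exact: le_lt_trans (flip _ _).
apply: (measurability _ (measurable_realfun.RGenOpens.measurableE R)).
move=> _ [_ [a [b ->] <-]]; rewrite setTI; apply: sub_sigma_algebra.
by apply: open_comp => // x _; exact: fcont.
Qed.

Lemma lip1_integrable f (m : {finite_measure set (borel B) -> \bar R}) :
  lip1 f -> m.-integrable [set: borel B] (EFin \o f).
Proof.
move=> f1; apply: measurable_bounded_integrable => //.
- by rewrite ltey_eq fin_num_measure.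
- exact: lip1_measurable.
- exists 1; split=> // M M1 x _ /=.
  by rewrite (le_trans _ (ltW M1))// ler_norml f1.2.
Qed.

(** If the difference of [mu] and [nu] has Jordan decomposition [p - n] then
    [mu + n = nu + p], and the integral is additive in nonnegative measures. *)
Lemma charge_integral_diff mu nu f : lip1 f ->
  charge_integral (charge_diff mu nu) f = \int[mu]_x f x - \int[nu]_x f x.
Proof.
move=> f1; rewrite /charge_integral; set P := hahnP _.
have additive (m1 m2 : {finite_measure set (borel B) -> \bar R}) :
    \int[measure_add m1 m2]_x f x = \int[m1]_x f x + \int[m2]_x f x.
  rewrite /Rintegral integral_measure_add//; try exact: lip1_integrable.
  by rewrite fineD//; exact: integrable_fin_num (lip1_integrable _ f1).
suff : \int[measure_add mu (jordan_neg P)]_x f x =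
       \int[measure_add nu (jordan_pos P)]_x f x.
  by rewrite (additive mu) (additive nu); lra.
rewrite /Rintegral; congr fine; apply: eq_measure_integral => A mA _.
suff AE : (mu A + jordan_neg P A = nu A + jordan_pos P A)%E.
  transitivity (mu A + jordan_neg P A)%E; first exact: measure_addE.
  by rewrite AE; exact/esym/measure_addE.
have : (mu A - nu A = jordan_pos P A - jordan_neg P A)%E.
  by rewrite [LHS](jordan_decomp P mA) /cadd/= /cscale EFinN mulN1e.
have fin (m : {finite_measure set (borel B) -> \bar R}) :
  m A = (fine (m A))%:E by rewrite fineK// fin_num_measure.
rewrite (fin mu) (fin nu) (fin (jordan_pos P)) (fin (jordan_neg P)).
rewrite -!EFinN -!EFinD => -[muE].
by congr EFin; lra.
Qed.

Lemma Rintegral_lip1_le1 mu f : lip1 f -> `|\int[mu]_x f x| <= 1.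
Proof.
move=> f1; rewrite (le_trans (le_normr_Rintegral _ (lip1_integrable mu f1)))//.
have -> : 1 = \int[mu]_x (cst 1 x).
  by rewrite Rintegral_cst// mul1r -[1]/(fine 1%:E) -(probability_setT mu).
apply: le_Rintegral => //.
- exact: (integrable_norm (lip1_integrable mu f1)).
- exact: finite_measure_integrable_cst.
- by move=> x _; rewrite /= ler_norml f1.2.
Qed.

Lemma Rintegral_lip1_sum mu n (c : 'I_n -> R)
    (F : 'I_n -> B -> R) : (forall i, lip1 (F i)) ->
  mu.-integrable [set: borel B] (EFin \o (fun y => \sum_i c i * F i y)) /\
  \int[mu]_y (\sum_i c i * F i y) = \sum_i c i * \int[mu]_y F i y.
Proof.
move=> F1; have int i : mu.-integrable setT (fun y => (c i * F i y)%:E).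
  exact: (integrableZl measurableT (c i) (lip1_integrable mu (F1 i))).
have sumE : EFin \o (fun y => \sum_i c i * F i y) =
    (fun y => \sum_i (c i * F i y)%:E)%E.
  by apply/funext => y /=; rewrite sumEFin.
split; first by rewrite sumE; exact: integrable_sum.
rewrite /Rintegral [X in fine (integral _ _ X)]sumE integral_sum//.
rewrite -sum_fine => [|i _]; last exact: integrable_fin_num (int i).
by apply: eq_bigr => i _; rewrite -RintegralZl//; exact: lip1_integrable.
Qed.

Lemma kr_dist_ub mu nu f : lip1 f ->
  `|\int[mu]_x f x - \int[nu]_x f x| <= kr_dist mu nu.
Proof.
move=> f1; rewrite -charge_integral_diff//; apply: ub_le_sup; last by exists f.
exists 2 => _ [g g1 <-]; rewrite charge_integral_diff//.
by rewrite (le_trans (ler_normB _ _))// lerD// Rintegral_lip1_le1.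
Qed.

Lemma kr_dist_le mu nu (c : R) :
  (forall f, lip1 f -> `|\int[mu]_x f x - \int[nu]_x f x| <= c) ->
  kr_dist mu nu <= c.
Proof.
move=> lec; apply: ge_sup.
  exists `|charge_integral (charge_diff mu nu) (cst 0)|, (cst 0) => //.
  by split=> [x y|x]; rewrite ?subrr ?normr0 ?mdist_ge0// lerN10 ler01.
by move=> _ [f f1 <-]; rewrite charge_integral_diff//; exact: lec.
Qed.

Lemma kr_dist_le2 mu nu : kr_dist mu nu <= 2.
Proof.
apply: kr_dist_le => f f1.
by rewrite (le_trans (ler_normB _ _))// lerD// Rintegral_lip1_le1.
Qed.

Section discrete.
Hypothesis discreteB : forall A : set B, open A.

Lemma discrete_measurable (A : set (borel B)) : measurable A.
Proof. by apply: sub_sigma_algebra; exact: discreteB. Qed.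

Fact dirac_nonborel (x : borel B) (A : set (borel B)) :
  ~ measurable A -> (\d_x A)%E = 0%E :> \bar R.
Proof. by case; exact: discrete_measurable. Qed.

(** In a discrete space every set is Borel, so that the Dirac measure satisfies
    vacuously the condition on non-Borel sets. *)
Definition point_mass (x : B) : PM B := MkPM (@dirac_nonborel x).

Lemma Rintegral_point_mass x f : \int[point_mass x]_y f y = f x.
Proof.
rewrite /Rintegral /= integral_dirac//.
- by rewrite diracT mul1e.
- by move=> _ A mA; rewrite setTI; exact: discrete_measurable.
Qed.

Lemma kr_dist_point_mass x y :
  kr_dist (point_mass x) (point_mass y) <= mdist x y.
Proof.
by apply: kr_dist_le => f [flip _]; rewrite !Rintegral_point_mass.
Qed.

Lemma PM_tau_point_mass x : PM_tau B (point_mass x).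
Proof.
move=> I le Z [_ _ _ _] _ Zdec Z0.
have [i Zix] : exists i, ~ Z i x.
  by apply/existsNP => Zx; rewrite -[False]/(set0 x) -Z0 => i _; exact: Zx.
move=> U /= /nbhs_singleton U0; exists i => // j /= ij.
by rewrite /= [X in U X](_ : _ = 0%E)// diracE memNset// => /(Zdec _ _ ij).
Qed.

Lemma PM_rho_point_mass x : PM_rho B (point_mass x).
Proof.
move=> A mA; apply/eqP; rewrite eq_le; apply/andP; split; last first.
  apply: ge_ereal_sup => _ [K [_ KA] <-] /=; apply: le_measure => //.
    by rewrite inE; exact: discrete_measurable.
  by rewrite inE.
have [Ax|nAx] := pselect (A x).
  apply: ereal_sup_ubound; exists [set x].
    by split; [exact: compact_set1|move=> _ ->].
  by rewrite /= !diracE !mem_set.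
rewrite /= diracE memNset//; apply: ereal_sup_ubound; exists set0.
  by split; [exact: compact0|].
by rewrite /= dirac0.
Qed.

Lemma PM_delta_point_mass x : PM_delta B (point_mass x).
Proof.
by exists 1%N, (fun=> 1), (fun=> x) => A _; rewrite big_ord1 mul1e.
Qed.

End discrete.
End kr.

(** * Correlations on the discrete cube *)

Section cube.
Variables (R : realFieldType) (n : nat).

Definition flip (i : 'I_n) (v : {ffun 'I_n -> bool}) : {ffun 'I_n -> bool} :=
  [ffun j => if j == i then ~~ v j else v j].

Lemma flipK i : involutive (flip i).
Proof.
by move=> v; apply/ffunP => j; rewrite !ffunE; case: (j == i); rewrite ?negbK.
Qed.

(** Flipping the [i]-th coordinate is a bijection of the cube that reverses the
    sign [(-1) ^+ v i]. Hence the sum over [v] of the [i]-th summand equals half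
    the sum over [v] of [(-1) ^+ v i * (a v i - a (flip i v) i)], which is at
    most [eta / 2] per vertex. The bound holds on average over [v], hence for
    some [v]. *)
Lemma correlation_with_vertex (a : {ffun 'I_n -> bool} -> 'I_n -> R) (eta : R) :
  (forall v i, `|a (flip i v) i - a v i| <= eta) ->
  exists v : {ffun 'I_n -> bool},
    \sum_i (-1) ^+ v i * a v i <= n%:R * (eta / 2).
Proof.
move=> a_flip.
have sum_le i : \sum_(v : {ffun 'I_n -> bool}) (-1) ^+ v i * a v i <=
    \sum_(v : {ffun 'I_n -> bool}) eta / 2.
  have E : \sum_(v : {ffun 'I_n -> bool}) (-1) ^+ v i * a v i =
      \sum_(v : {ffun 'I_n -> bool}) - ((-1) ^+ v i * a (flip i v) i).
    rewrite [LHS](reindex_inj (can_inj (flipK i))) /=; apply: eq_bigr => v _.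
    by rewrite ffunE eqxx signrN mulNr.
  suff : \sum_(v : {ffun 'I_n -> bool})
        ((-1) ^+ v i * a v i - (-1) ^+ v i * a (flip i v) i) <=
      \sum_(v : {ffun 'I_n -> bool}) eta.
    by rewrite big_split /= -E -mulr2n -mulr_suml; lra.
  apply: ler_sum => v _; rewrite -mulrBr.
  rewrite (le_trans (ler_norm _))// normrM normr_sign mul1r distrC.
  exact: a_flip.
apply: contrapT => none.
suff : \sum_(v : {ffun 'I_n -> bool}) n%:R * (eta / 2) <
    \sum_(v : {ffun 'I_n -> bool}) \sum_i (-1) ^+ v i * a v i.
  rewrite exchange_big /= ltNge => /negP[].
  rewrite (le_trans (ler_sum _ (fun i _ => sum_le i)))//.
  rewrite exchange_big /=.
  by under eq_bigr do rewrite sumr_const card_ord -[_ *+ n]mulr_natl.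
apply: ltr_sum => [|v _].
  by apply/hasP; exists [ffun=> true]; rewrite ?mem_index_enum.
by rewrite ltNge; apply/negP => le; apply: none; exists v.
Qed.
End cube.

(** * The space of tips *)

Section hamming.
Variable R : realFieldType.
Implicit Types x y z : (nat * nat) * seq bool.

(** The point [((m, n), s)] stands for the vertex of the [(m, n)]-th cube whose
    coordinates are the first [n + 1] bits of [s], padded with [false]. Distinct
    [s] may give the same vertex, so this is a pseudometric only. It saves a
    dependent type of points; the whiskers restore separation. *)
Definition hamming x y : R :=
  if x.1 == y.1 then
    (\sum_(i < x.1.2.+1) (nth false x.2 i != nth false y.2 i)%:R) / x.1.2.+1%:R
  else 1.

(** The length of the whisker at [x]. *)
Definition gap x : R := x.1.1.+1%:R^-1.

Lemma hammingxx x : hamming x x = 0.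
Proof.
by rewrite /hamming eqxx big1 ?mul0r// => i _; rewrite eqxx.
Qed.

Lemma hamming_ge0 x y : 0 <= hamming x y.
Proof.
by rewrite /hamming; case: ifP => // _; rewrite divr_ge0 ?ler0n ?sumr_ge0.
Qed.

Lemma hamming_le1 x y : hamming x y <= 1.
Proof.
rewrite /hamming; case: ifP => // _; rewrite ler_pdivrMr ?ltr0n// mul1r.
rewrite -[leRHS]mulr1 mulr_natl -[X in _ *+ X]card_ord -sumr_const.
by apply: ler_sum => i _; rewrite lern1 leq_b1.
Qed.

Lemma hammingC x y : hamming x y = hamming y x.
Proof.
rewrite /hamming eq_sym; case: eqP => // ->.
by congr (_ / _); apply: eq_bigr => i _; rewrite eq_sym.
Qed.

Lemma hamming_triangle y x z : hamming x z <= hamming x y + hamming y z.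
Proof.
have [xy|xy] := eqVneq x.1 y.1; last first.
  rewrite (le_trans (hamming_le1 _ _))// {1}/hamming (negbTE xy).
  by rewrite lerDl hamming_ge0.
have [yz|yz] := eqVneq y.1 z.1; last first.
  rewrite (le_trans (hamming_le1 _ _))// [X in _ + X]/hamming (negbTE yz).
  by rewrite lerDr hamming_ge0.
rewrite /hamming xy yz !eqxx -mulrDl ler_wpM2r ?invr_ge0 ?ler0n//.
rewrite -big_split; apply: ler_sum => i _ /=; rewrite -natrD ler_nat.
by do 3!case: (nth false _ i).
Qed.

Lemma gap_gt0 x : 0 < gap x. Proof. by rewrite invr_gt0 ltr0n. Qed.

Lemma gap_le1 x : gap x <= 1.
Proof. by rewrite invf_le1 ?ltr0n// ler1n. Qed.

End hamming.

(** A copy of the product type, so that its metric is not confused with the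
    product structure; the parameter [R] lets the field of distances be inferred
    from the type. *)
Definition tips (R : realType) : Type := ((nat * nat) * seq bool)%type.

Section tips.
Variable R : realType.
Implicit Types x y z : tips R.

HB.instance Definition _ :=
  Countable.copy (tips R) ((nat * nat) * seq bool)%type.
HB.instance Definition _ := isPointed.Build (tips R) (0, 0, [::])%N.

(** Down one whisker, across the cubes, and up another whisker. *)
Definition tip_dist x y : R :=
  if x == y then 0 else hamming R x y + gap R x + gap R y.

Fact tip_distxx x : tip_dist x x = 0.
Proof. by rewrite /tip_dist eqxx. Qed.

Fact tip_dist_positivity x y : tip_dist x y = 0 -> x = y.
Proof.
rewrite /tip_dist; case: eqP => // _ xy0; exfalso; move: xy0.
have := hamming_ge0 R x y; have := gap_gt0 R x; have := gap_gt0 R y; lra.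
Qed.

Fact tip_dist_sym x y : tip_dist x y = tip_dist y x.
Proof. by rewrite /tip_dist eq_sym hammingC addrAC. Qed.

Fact tip_dist_triangle y x z : tip_dist x z <= tip_dist x y + tip_dist y z.
Proof.
rewrite /tip_dist; have := hamming_triangle R y x z.
have := hamming_ge0 R x y; have := hamming_ge0 R y z.
have := gap_gt0 R x; have := gap_gt0 R y; have := gap_gt0 R z.
by case: eqP => xz; case: eqP => xy; case: eqP => yz; subst => //; lra.
Qed.

HB.instance Definition _ := isMetric.Build R (tips R)
  tip_distxx tip_dist_positivity tip_dist_sym tip_dist_triangle.

Lemma tips_discrete (A : set (tips R)) : open A.
Proof.
rewrite openE => x Ax; apply/nbhs_ballP; exists (gap R x) => [|y] /=.
  exact: gap_gt0.
rewrite ballEmdist /= [mdist x y]/(tip_dist x y) /tip_dist.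
case: eqP => [<-//|_ xy]; exfalso; move: xy.
have := hamming_ge0 R x y; have := gap_gt0 R y; lra.
Qed.

Lemma tips_separable : separable (tips R).
Proof.
exists setT; first exact: countableP.
by move=> U [x Ux] _; exists x.
Qed.

Lemma hamming_le_mdist x y : hamming R x y <= mdist x y.
Proof.
rewrite [mdist x y]/(tip_dist x y) /tip_dist; case: eqP => [->|_].
  by rewrite hammingxx.
by have := gap_gt0 R x; have := gap_gt0 R y; lra.
Qed.

Lemma hamming_lip1 x : lip1 (hamming R x : tips R -> R).
Proof.
split=> [y z|y]; last first.
  by have := hamming_ge0 R x y; have := hamming_le1 R x y; lra.
have := hamming_triangle R y x z; have := hamming_triangle R z x y.
by rewrite (hammingC R z) ler_norml; have := hamming_le_mdist y z; lra.
Qed.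

(** The factor [gap R y] makes the sign of a coordinate 1-Lipschitz: distinct
    tips [y] and [z] are at least [gap R y + gap R z] apart, however close the
    corresponding vertices are. *)
Definition coordinate (m n : nat) (i : 'I_n.+1) (y : tips R) : R :=
  if y.1 == (m, n) then gap R y * (-1) ^+ nth false y.2 i else 0.

Lemma coordinate_lip1 m n (i : 'I_n.+1) : lip1 (coordinate m i).
Proof.
have bound y : `|coordinate m i y| <= gap R y.
  rewrite /coordinate; case: ifP => _; last by rewrite normr0 ltW ?gap_gt0.
  by rewrite normrM normr_sign mulr1 gtr0_norm ?gap_gt0.
split=> [y z|y]; last by rewrite -ler_norml (le_trans (bound y))// gap_le1.
rewrite [mdist y z]/(tip_dist y z) /tip_dist; case: eqP => [->|_].
  by rewrite subrr normr0.
rewrite (le_trans (ler_normB _ _))// (le_trans (lerD (bound y) (bound z)))//.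
by have := hamming_ge0 R y z; lra.
Qed.

Definition vertex (m n : nat) (v : {ffun 'I_n.+1 -> bool}) : tips R :=
  ((m, n), [seq v i | i <- enum 'I_n.+1]).

Lemma nth_vertex n (v : {ffun 'I_n -> bool}) (i : 'I_n) :
  nth false [seq v j | j <- enum 'I_n] i = v i.
Proof. by rewrite (nth_map i) ?size_enum_ord// nth_ord_enum. Qed.

Lemma hamming_flip m n (v : {ffun 'I_n.+1 -> bool}) (i : 'I_n.+1) :
  hamming R (vertex m (flip i v)) (vertex m v) = n.+1%:R^-1.
Proof.
rewrite /hamming eqxx (bigD1 i)//= big1 => [|j ji].
  by rewrite !nth_vertex /flip ffunE eqxx; case: (v i); rewrite addr0 mul1r.
by rewrite !nth_vertex /flip ffunE (negbTE ji) eqxx.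
Qed.

(** On the cube of [v] the sum of the products of signs counts agreements minus
    disagreements, and there equality holds; elsewhere the left-hand side is
    negative and the right-hand side is 0. *)
Lemma hamming_coordinates m n (v : {ffun 'I_n.+1 -> bool}) y :
  n.+1%:R * m.+1%:R^-1 * (1 - 2 * hamming R (vertex m v) y) <=
  \sum_i (-1) ^+ v i * coordinate m i y.
Proof.
rewrite /hamming /coordinate eq_sym /=; case: eqP => [ymn|_]; last first.
  rewrite big1 => [|i _]; last by rewrite mulr0.
  by rewrite pmulr_rle0 ?divr_gt0 ?ltr0n//; lra.
rewrite /gap ymn /= [X in X <= _](_ : _ = m.+1%:R^-1 *
    (n.+1%:R - 2 * \sum_(i < n.+1) (v i != nth false y.2 i)%:R)); last first.
  have -> : \sum_(i < n.+1) (nth false (vertex m v).2 i != nth false y.2 i)%:R =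
      \sum_(i < n.+1) (v i != nth false y.2 i)%:R :> R.
    by apply: eq_bigr => i _; rewrite nth_vertex.
  by field; rewrite !nat1r !pnatr_eq0.
rewrite -[X in X%:R - _]card_ord -sum1_card natr_sum mulr_sumr -sumrB mulr_sumr.
apply: ler_sum => i _; set c := _^-1.
by case: (v i); case: (nth false y.2 i); rewrite /= ?expr0 ?expr1; lra.
Qed.
End tips.

Section main.
Variable R : realType.

Lemma harmonic_small (e : R) : 0 < e -> exists n : nat, n.+1%:R^-1 < e.
Proof.
move=> e0.
have /cvgr0Pnorm_lt/(_ e e0)[n _ /(_ n (leqnn n))] := @cvg_harmonic R.
by rewrite /= ger0_norm ?invr_ge0 ?ler0n//; exists n.
Qed.

Local Notation B := (tips R).
Local Notation delta_at := (point_mass (@tips_discrete R)).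

(** A family of measures that varies slowly along the edges of the cube cannot
    follow the vertices. By [correlation_with_vertex] and [hamming_coordinates],
    for some [v] the average [I] of [hamming v] against [mu v] satisfies
    [1 - 2 I <= 1 / 4], while its average against the Dirac measure at [v] is
    0. *)
Lemma far_from_vertex (m n : nat) (mu : {ffun 'I_n.+1 -> bool} -> PM B) :
  (forall v i, kr_dist (mu (flip i v)) (mu v) < m.+1%:R^-1 / 2) ->
  exists v, 1 / 4 < kr_dist (mu v) (delta_at (vertex R m v)).
Proof.
move=> mu_flip.
have [v vle] := @correlation_with_vertex R n.+1
  (fun v i => \int[mu v]_y coordinate m i y) (m.+1%:R^-1 / 2)
  (fun v i => le_trans (kr_dist_ub _ _ (coordinate_lip1 R m i))
                       (ltW (mu_flip v i))).
exists v; set x := vertex R m v; set D := kr_dist _ _.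
have hamD : \int[mu v]_y hamming R x y <= D.
  have := kr_dist_ub (mu v) (delta_at x) (hamming_lip1 x).
  rewrite Rintegral_point_mass hammingxx subr0.
  exact: le_trans (ler_norm _).
have [sum_int sumE] := Rintegral_lip1_sum (mu v)
  (fun i => (-1) ^+ v i) (fun i => coordinate_lip1 R m i).
pose c : R := n.+1%:R * m.+1%:R^-1.
have c0 : 0 < c by rewrite divr_gt0 ?ltr0n.
have ham_int := lip1_integrable (mu v) (hamming_lip1 x).
have one_int := finite_measure_integrable_cst (mu v) c measurableT.
have lin_int : (mu v).-integrable setT
  (EFin \o (fun y => c - c * 2 * hamming R x y)).
  exact: (integrableB measurableT one_int
    (integrableZl measurableT (c * 2) ham_int)).
have : c * (1 - 2 * \int[mu v]_y hamming R x y) <=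
    n.+1%:R * (m.+1%:R^-1 / 2 / 2).
  apply: le_trans vle; rewrite -sumE.
  have -> : c * (1 - 2 * \int[mu v]_y hamming R x y) =
      \int[mu v]_y (c - c * 2 * hamming R x y).
    rewrite RintegralB//; last first.
      exact: (integrableZl measurableT (c * 2) ham_int).
    rewrite Rintegral_cst// RintegralZl// [fine _](_ : _ = 1); first by ring.
    by rewrite -[1]/(fine 1%:E) -(probability_setT (mu v)).
  apply: le_Rintegral => // y _.
  apply: le_trans (hamming_coordinates m v y).
  by rewrite -/c -/x; lra.
have -> : n.+1%:R * (m.+1%:R^-1 / 2 / 2) = c * (1 / 4) by rewrite /c; field.
rewrite ler_pM2l//; lra.
Qed.

(** The order of the choices matters: [m] makes the whiskers so short that [Phi]
    is 1/4-close to the Dirac measures, and only then is [n] taken so large that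
    the edges of the cube are short compared with the modulus of continuity of
    [Phi] at scale [1 / (m + 1)]. [B] contains cubes for all pairs because this
    modulus is not known in advance. *)
Theorem not_uniform_AR_of_point_masses (P : set (PM B)) :
  (forall x, P (delta_at x)) -> ~ uniform_AR R (set_type P).
Proof.
move=> Ppoint AR.
pose phi (x : B) : set_type P := SigSub (mem_set (Ppoint x)).
pose d (mu nu : set_type P) := kr_dist (set_val mu) (set_val nu).
have [Phi PhiP] : exists Phi : B -> set_type P,
    forall eps : R, 0 < eps -> exists2 delta : R, 0 < delta &
    (forall x y, hamming R x y < delta -> `|gap R x - gap R y| < delta ->
      d (Phi x) (Phi y) < eps) /\
    (forall x, gap R x < delta -> d (Phi x) (phi x) < eps).
  apply: (@uniform_AR_approx_extension _ _ d 2) AR.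
  - by move=> mu; exact: kr_distxx.
  - by move=> mu nu; exact: kr_dist_sym.
  - by move=> mu nu la; exact: kr_dist_triangle.
  - by move=> mu nu /kr_dist_positivity/val_inj.
  - by move=> mu nu; exact: kr_dist_le2.
  - exact: entourage_set_PM.
  - exact: hammingxx.
  - exact: hammingC.
  - exact: hamming_triangle.
  - exact: gap_gt0.
  - move=> x y; rewrite /d /=.
    rewrite (le_trans (kr_dist_point_mass _ _ _))//.
    rewrite [mdist x y]/(tip_dist x y) /tip_dist; case: eqP => // _.
    by rewrite !addr_ge0 ?hamming_ge0// ltW ?gap_gt0.
have [|delta delta0 [_ near_phi]] := PhiP (1 / 4); first by lra.
have [m mdelta] := harmonic_small delta0.
have [|eta eta0 [Phi_cont _]] := PhiP (m.+1%:R^-1 / 2).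
  by rewrite divr_gt0 ?invr_gt0 ?ltr0n.
have [n neta] := harmonic_small eta0.
have [|v] := @far_from_vertex m n (fun v => set_val (Phi (vertex R m v))).
  move=> v i; apply: Phi_cont; first by rewrite hamming_flip.
  by rewrite subrr normr0.
by rewrite ltNge ltW//; apply: near_phi.
Qed.
End main.

Theorem proposition28p2 (R : realType) :
  exists B : pmetricType R,
    separable B /\
    ~ uniform_AR R (set_type (PM_tau B)) /\
    ~ uniform_AR R (set_type (PM_rho B)) /\
    ~ uniform_AR R (set_type (PM_delta B)).
Proof.
exists (tips R); split; first exact: tips_separable.
split; [|split]; apply: not_uniform_AR_of_point_masses => x.
- exact: PM_tau_point_mass.
- exact: PM_rho_point_mass.
- exact: PM_delta_point_mass.
Qed.
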